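(* For every integer $j \geq 3$, $$m_j(B, P_4) = \begin{cases} 3 & \text{if } j = 3,\\ 2 & \text{if } j \in \{4,5,6\},\\ 1 & \text{otherwise.}\end{cases}$$
   Context: All graphs are simple. $K_{j\times s}$ denotes the complete multipartite graph with $j$ partite sets, each of size $s$. The Butterfly graph $B$ is the graph on 5 vertices consisting of two copies of the triangle $C_3$ sharing exactly one common vertex. $P_4$ denotes the path on 4 vertices. For graphs $B$ and $G$ and an integer $j\ge 2$, the size multipartite Ramsey number $m_j(B,G)$ is the smallest natural number $s$ such that every colouring of the edges of $K_{j\times s}$ with two colours, red and blue, contains a red copy of $B$ or a blue copy of $G$; if no such $s$ exists, $m_j(B,G)=\infty$. *)

(* Defs.v *)
From HB Require Import structures.
From mathcomp Require Import all_boot.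
From mathcomp Require Import boolp.

Set Implicit Arguments.
Unset Strict Implicit.
Unset Printing Implicit Defensive.

Record sgraph := SGraph {
  vertex :> finType;
  adj : rel vertex;
  adj_sym : symmetric adj;
  adj_irrefl : irreflexive adj
}.

Definition multipartite_rel (j s : nat) : rel ('I_j * 'I_s) :=
  fun x y => x.1 != y.1.

Lemma multipartite_sym j s : symmetric (@multipartite_rel j s).
Proof. by move=> x y; rewrite /multipartite_rel eq_sym. Qed.

Lemma multipartite_irrefl j s : irreflexive (@multipartite_rel j s).
Proof. by move=> x; rewrite /multipartite_rel eqxx. Qed.

(* The partite sets are the fibres of the first projection. *)
Definition complete_multipartite (j s : nat) : sgraph :=
  SGraph (@multipartite_sym j s) (@multipartite_irrefl j s).

(* The triangles are {0, 1, 2} and {2, 3, 4}. *)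
Definition butterfly_rel : rel 'I_5 :=
  fun x y => (x != y) && ((x <= 2) && (y <= 2) || (2 <= x) && (2 <= y)).

Lemma butterfly_sym : symmetric butterfly_rel.
Proof.
by move=> x y; rewrite /butterfly_rel eq_sym (andbC (x <= 2)) (andbC (2 <= x)).
Qed.

Lemma butterfly_irrefl : irreflexive butterfly_rel.
Proof. by move=> x; rewrite /butterfly_rel eqxx. Qed.

Definition butterfly : sgraph := SGraph butterfly_sym butterfly_irrefl.

Definition path_rel (n : nat) : rel 'I_n :=
  fun x y => (x.+1 == y :> nat) || (y.+1 == x :> nat).

Lemma path_sym n : symmetric (@path_rel n).
Proof. by move=> x y; rewrite /path_rel orbC. Qed.

Lemma path_irrefl n : irreflexive (@path_rel n).
Proof. by move=> x; rewrite /path_rel orbb gtn_eqF. Qed.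

(* Indexed by the number of vertices, not of edges. *)
Definition path_graph (n : nat) : sgraph :=
  SGraph (@path_sym n) (@path_irrefl n).

Inductive color := Red | Blue.

Definition bool_of_color (a : color) : bool := if a is Red then true else false.
Definition color_of_bool (b : bool) : color := if b then Red else Blue.

Lemma bool_of_colorK : cancel bool_of_color color_of_bool.
Proof. by case. Qed.

HB.instance Definition _ := Finite.copy color (can_type bool_of_colorK).

(* An edge is the unordered pair of its ends. *)
Definition edges (G : sgraph) : {set {set G}} :=
  [set [set p.1; p.2] | p : G * G & adj p.1 p.2].

Definition edge_coloring (G : sgraph) : finType :=
  {ffun {e : {set G} | e \in edges G} -> color}.

(* Copies are subgraphs, not necessarily induced. *)
Definition has_copy (G H : sgraph) (c : edge_coloring G) (a : color) : bool :=
  [exists f : {ffun H -> G}, injectiveb f &&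
    [forall x, forall y, adj x y ==>
      [exists e : {e : {set G} | e \in edges G},
        (val e == [set f x; f y]) && (c e == a)]]].

Definition arrows (K G1 G2 : sgraph) : bool :=
  [forall c : edge_coloring K, has_copy G1 c Red || has_copy G2 c Blue].

(* [None] stands for infinity. *)
Definition multipartite_ramsey (j : nat) (G1 G2 : sgraph) : option nat :=
  match pselect (exists s, arrows (complete_multipartite j s) G1 G2) with
  | left ex_s => Some (ex_minn ex_s)
  | right _ => None
  end.

(* Main.v *)
(** The threshold is governed by the number j * s of vertices: 6 are never
    enough and, for j >= 3, any larger number is. With at most 6 vertices, split them into two sets
    of size at most 3 and color blue the edges inside the two sets: the blue
    components are too small for P_4, and the red graph is bipartite, hence
    triangle-free. For the upper bounds, K_{3x3}, K_{4x2} and K_{7x1} embed in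
    the multipartite graphs at hand, and the absence of both a blue P_4 and a
    red butterfly in them is a propositional formula over the edge colors,
    which a verified branching search refutes. *)
Require Import Defs.
From mathcomp Require Import all_boot.
From mathcomp Require boolp.
From mathcomp Require Import zify.

Set Implicit Arguments.
Unset Strict Implicit.
Unset Printing Implicit Defensive.

(** * Refutation of propositional formulas by branching *)

Definition negl (T : eqType) (l : T * bool) : T * bool := (l.1, ~~ l.2).

(** Formulas are in conjunctive normal form; the literal [(x, b)] asserts that the variable [x] has
    value [b]. *)
Definition satisfies (T : eqType) (v : T -> bool) (F : seq (seq (T * bool))) :=
  all (has (fun l => v l.1 == l.2)) F.

Definition assign (T : eqType) (l : T * bool) (F : seq (seq (T * bool))) :=
  [seq [seq l' <- C | l' != negl l] | C <- F & l \notin C].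

Definition shorter (T : eqType) (C D : seq T) :=
  if size C <= size D then C else D.

(** Branching on a literal of a shortest clause subsumes unit propagation: for a unit clause, the
    second branch contains the empty clause at once. *)
Fixpoint refuted (T : eqType) (depth : nat) (F : seq (seq (T * bool))) : bool :=
  ([::] \in F) ||
  if depth is d.+1 then
    (* The fold starts from a clause of [F], as [[::]] would always win the comparison. *)
    if foldr (@shorter _) (head [::] F) F is l :: _ then
      refuted d (assign l F) && refuted d (assign (negl l) F)
    else false
  else false.

Lemma satisfies_assign (T : eqType) (v : T -> bool) l F :
  v l.1 = l.2 -> satisfies v F -> satisfies v (assign l F).
Proof.
move=> vl /allP satF; apply/allP=> _ /mapP[C + ->].
rewrite mem_filter => /andP[_ /satF/hasP[l' Cl' vl']].
apply/hasP; exists l' => //; rewrite mem_filter Cl' andbT.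
by apply: contraTneq vl' => ->; rewrite /= vl; case: l.2.
Qed.

Lemma refutedP (T : eqType) d (F : seq (seq (T * bool))) (v : T -> bool) :
  refuted d F -> ~~ satisfies v F.
Proof.
elim: d F => [|d IHd] F /=; case nilF: ([::] \in F) => //=.
- by move=> _; apply/negP=> /allP/(_ _ nilF).
- by move=> _; apply/negP=> /allP/(_ _ nilF).
case: foldr => // l _ /andP[/IHd unsat_l /IHd unsat_nl].
have [vl|vl] := eqVneq (v l.1) l.2.
  by apply: contra unsat_l; apply: satisfies_assign.
apply: contra unsat_nl; apply: satisfies_assign.
by rewrite /=; case: (v _) l.2 vl => -[].
Qed.

(** * Placements of a small graph and the Ramsey formula *)

(* The smaller end comes first: [placements] below checks an edge when its second
   end is placed. *)
Definition butterfly_edges := [:: (0, 1); (0, 2); (1, 2); (2, 3); (2, 4); (3, 4)].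
Definition path4_edges := [:: (0, 1); (1, 2); (2, 3)].

Fixpoint placements (part : nat -> nat) (n : nat) (E : seq (nat * nat)) (m : nat)
    : seq (seq nat) :=
  if m is m'.+1 then
    [seq rcons t x | t <- placements part n E m', x <- [seq x <- iota 0 n |
      (x \notin t) &&
      all (fun e => (e.2 == m') ==> (part (nth 0 t e.1) != part x)) E]]
  else [:: [::]].

(** Soundness of the enumeration suffices: a missed placement would only drop a clause and make the
    formula harder to refute. *)
Lemma placementsP part n E m t : t \in placements part n E m ->
  [/\ size t = m, uniq t, all (gtn n) t &
      forall e, e \in E -> e.1 < e.2 < m ->
        part (nth 0 t e.1) != part (nth 0 t e.2)].
Proof.
elim: m t => [|m IHm] t /=.
  by rewrite inE => /eqP->; split=> // e _; rewrite ltn0 andbF.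
case/allpairsPdep=> u [x [/IHm[size_u uniq_u ltun partu]]].
rewrite mem_filter mem_iota add0n => /andP[/andP[ux /allP partx] ltxn] ->.
rewrite size_rcons size_u rcons_uniq ux uniq_u all_rcons ltun /= andbT.
split=> // e Ee /andP[lt12]; rewrite ltnS => le2m.
rewrite !nth_rcons size_u (leq_trans lt12 le2m).
(* An edge that ends before the new vertex lies in the prefix [u]; one that ends at it has just
   passed the filter. *)
have [lt2m|] := ltnP e.2 m; first by apply: partu; rewrite ?lt12.
move=> lem2; have e2m : e.2 == m by rewrite eqn_leq le2m.
by rewrite e2m; have := partx e Ee; rewrite e2m.
Qed.

(* A clause is a list of literals [((x, y), b)] with [x < y], read as "the edge
   [xy] is red if [b], blue otherwise"; this one says that the placed copy is
   not monochromatic in the color [b]. *)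
Definition avoid (b : bool) (E : seq (nat * nat)) (t : seq nat) :=
  [seq (let x := nth 0 t e.1 in let y := nth 0 t e.2 in
        ((minn x y, maxn x y), ~~ b)) | e <- E].

(* The inequalities on the entries of [t] select one placement from each orbit
   of the automorphism group of the placed graph. *)
Definition ramsey_clauses (j s : nat) :=
  [seq avoid false path4_edges t
     | t <- placements (divn^~ s) (j * s) path4_edges 4 & nth 0 t 0 < nth 0 t 3]
  ++
  [seq avoid true butterfly_edges t
     | t <- placements (divn^~ s) (j * s) butterfly_edges 5
     & [&& nth 0 t 0 < nth 0 t 1, nth 0 t 3 < nth 0 t 4
         & nth 0 t 0 < nth 0 t 3]].

(** * From a violated clause to a monochromatic copy *)

Definition colored (K : sgraph) (c : edge_coloring K) (a : color) (x y : K) :=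
  [exists e : {e : {set K} | e \in edges K}, (val e == [set x; y]) && (c e == a)].

Lemma coloredC (K : sgraph) (c : edge_coloring K) a x y :
  colored c a x y = colored c a y x.
Proof. by rewrite /colored setUC. Qed.

(** Adjacency matters here: a pair that is not an edge is neither red nor blue. *)
Lemma colored_adj (K : sgraph) (c : edge_coloring K) x y :
  adj x y -> ~~ colored c Red x y -> colored c Blue x y.
Proof.
move=> xy; have Exy : [set x; y] \in edges K by apply/imsetP; exists (x, y); rewrite ?inE.
pose e : {e : {set K} | e \in edges K} := exist (fun e => e \in edges K) _ Exy.
move=> /existsPn/(_ e); rewrite eqxx /= => cR.
apply/existsP; exists e; rewrite eqxx /=.
by case: (c _) cR.
Qed.

Lemma has_copy_placement (K H : sgraph) (c : edge_coloring K) a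
    (emb : nat -> K) (idx : H -> nat) (E : seq (nat * nat)) n t :
    {in gtn n &, injective emb} -> injective idx ->
    (forall x, idx x < size t) ->
    (forall x y, adj x y -> ((idx x, idx y) \in E) || ((idx y, idx x) \in E)) ->
    uniq t -> all (gtn n) t ->
    (forall e, e \in E -> colored c a (emb (nth 0 t e.1)) (emb (nth 0 t e.2))) ->
  has_copy H c a.
Proof.
move=> emb_inj idx_inj idx_lt adjE uniq_t /allP ltn_t cE.
apply/existsP; exists [ffun x => emb (nth 0 t (idx x))]; apply/andP; split.
  apply/injectiveP=> x y; rewrite !ffunE => /emb_inj.
  move=> /(_ (ltn_t _ (mem_nth 0 (idx_lt x))) (ltn_t _ (mem_nth 0 (idx_lt y)))).
  by move/eqP; rewrite nth_uniq ?idx_lt // => /eqP/idx_inj.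
apply/forallP=> x; apply/forallP=> y; apply/implyP=> /adjE; rewrite !ffunE.
rewrite -/(colored c a _ _).
by case/orP=> /cE //; rewrite coloredC.
Qed.

Lemma not_avoid_colored (K : sgraph) (c : edge_coloring K) (emb : nat -> K)
    (part : nat -> nat) b E n m t :
    {in gtn n &, forall x y, part x != part y -> adj (emb x) (emb y)} ->
    all (fun e => e.1 < e.2 < m) E -> t \in placements part n E m ->
    ~~ has (fun l => colored c Red (emb l.1.1) (emb l.1.2) == l.2) (avoid b E t) ->
  forall e, e \in E ->
    colored c (if b then Red else Blue) (emb (nth 0 t e.1)) (emb (nth 0 t e.2)).
Proof.
move=> adj_emb /allP ltE /placementsP[size_t _ /allP lt_t part_t] + e Ee.
rewrite has_map => /hasPn/(_ e Ee) /=.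
set x := nth 0 t e.1; set y := nth 0 t e.2.
have -> : colored c Red (emb (minn x y)) (emb (maxn x y)) =
          colored c Red (emb x) (emb y).
  by have [_|_] := leqP x y; rewrite // coloredC.
case: b => /=; first by rewrite eqbF_neg negbK.
rewrite eqb_id; have /andP[lt12 lt2m] := ltE e Ee; apply: colored_adj.
apply: adj_emb; last by apply: part_t; rewrite ?lt12.
  by apply: lt_t; rewrite mem_nth // size_t (ltn_trans lt12).
by apply: lt_t; rewrite mem_nth // size_t.
Qed.

Lemma butterfly_edgesP (x y : butterfly) : adj x y ->
  ((x : nat, y : nat) \in butterfly_edges) || ((y : nat, x : nat) \in butterfly_edges).
Proof. by case: x y => [[|[|[|[|[|//]]]]] ?] [[|[|[|[|[|//]]]]] ?]. Qed.

Lemma path4_edgesP (x y : path_graph 4) : adj x y ->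
  ((x : nat, y : nat) \in path4_edges) || ((y : nat, x : nat) \in path4_edges).
Proof. by case: x y => [[|[|[|[|//]]]] ?] [[|[|[|[|//]]]] ?]. Qed.

Lemma refuted_arrows d j0 s j : j0 <= j -> 0 < s -> 0 < j ->
    refuted d (ramsey_clauses j0 s) ->
  arrows (complete_multipartite j s) butterfly (path_graph 4).
Proof.
(* Successors make both ordinal types inhabited, as [inord] requires. *)
case: s j => [//|s] [//|j] le_j0j _ _.
pose emb (k : nat) : complete_multipartite j.+1 s.+1 :=
  (inord (k %/ s.+1), inord (k %% s.+1)).
have lt_part k : k < j0 * s.+1 -> k %/ s.+1 < j.+1.
  by move=> ltk; apply: leq_trans le_j0j; rewrite ltn_divLR.
have emb_inj : {in gtn (j0 * s.+1) &, injective emb}.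
  move=> x y ltx lty [/(congr1 val) /= + /(congr1 val) /=].
  rewrite !inordK ?lt_part ?ltn_pmod // => eq_div eq_mod.
  by rewrite (divn_eq x s.+1) (divn_eq y s.+1) eq_div eq_mod.
have adj_emb : {in gtn (j0 * s.+1) &, forall x y,
    x %/ s.+1 != y %/ s.+1 -> adj (emb x) (emb y)}.
  move=> x y ltx lty; apply: contra => /eqP/(congr1 val) /=.
  by rewrite !inordK ?lt_part // => ->.
move=> refF; apply/forallP=> c.
(* The red edges of [c] form a valuation. A clause that it violates gives a blue path or a red
   butterfly, according to the half of the formula it comes from. *)
have := refutedP (fun e => colored c Red (emb e.1) (emb e.2)) refF.
rewrite /satisfies all_cat negb_and !all_map => /orP[] /allPn[t];
  rewrite mem_filter => /andP[_ tP] not_avoided;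
  have [size_t uniq_t lt_t _] := placementsP tP; apply/orP; [right|left];
  have := not_avoid_colored adj_emb _ tP not_avoided;
  move=> /(_ isT) cE.
- apply: (@has_copy_placement _ (path_graph 4) c Blue emb (@nat_of_ord 4) _ _ _
    emb_inj (@ord_inj _) _ path4_edgesP uniq_t lt_t cE).
  by move=> x; rewrite size_t; apply: ltn_ord.
- apply: (@has_copy_placement _ (butterfly) c Red emb (@nat_of_ord 5) _ _ _
    emb_inj (@ord_inj _) _ butterfly_edgesP uniq_t lt_t cE).
  by move=> x; rewrite size_t; apply: ltn_ord.
Qed.

(* K_{3x3}, the largest of the three graphs, has 27 edges, and every step of the
   search fixes the color of one more edge. *)
Lemma refuted_ramsey_clauses_7_1 : refuted 27 (ramsey_clauses 7 1).
Proof. by vm_compute. Qed.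

Lemma refuted_ramsey_clauses_4_2 : refuted 27 (ramsey_clauses 4 2).
Proof. by vm_compute. Qed.

Lemma refuted_ramsey_clauses_3_3 : refuted 27 (ramsey_clauses 3 3).
Proof. by vm_compute. Qed.

(** * The coloring that avoids both graphs on at most 6 vertices *)

Definition split_coloring (K : sgraph) (A : {set K}) : edge_coloring K :=
  [ffun e : {e : {set K} | e \in edges K} =>
    if (val e \subset A) || (val e \subset ~: A) then Blue else Red].

Lemma colored_split (K : sgraph) (A : {set K}) a x y :
  colored (split_coloring A) a x y ->
  ((x \in A) == (y \in A)) = (a == Blue).
Proof.
case/existsP=> e /andP[/eqP val_e]; rewrite ffunE val_e !subUset !sub1set !inE.
by case: (x \in A) (y \in A) => -[] /eqP<-.
Qed.

Lemma split_no_red_butterfly (K : sgraph) (A : {set K}) :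
  ~~ has_copy butterfly (split_coloring A) Red.
Proof.
apply/existsP=> -[f /andP[_ /forallP fP]].
have diff (x y : butterfly) : adj x y -> (f x \in A) != (f y \in A).
  move=> xy; have /forallP/(_ y)/implyP/(_ xy) := fP x.
  by move=> /(@colored_split _ _ Red)->.
pose i k : butterfly := @inord 4 k.
have e01 : adj (i 0) (i 1) by rewrite /= /butterfly_rel -val_eqE /= !inordK.
have e02 : adj (i 0) (i 2) by rewrite /= /butterfly_rel -val_eqE /= !inordK.
have e12 : adj (i 1) (i 2) by rewrite /= /butterfly_rel -val_eqE /= !inordK.
(* Three vertices of a triangle cannot lie pairwise on different sides of a cut. *)
move: (diff _ _ e01) (diff _ _ e02) (diff _ _ e12).
by case: (_ \in A) (_ \in A) (_ \in A) => -[] [].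
Qed.

Lemma split_no_blue_path (K : sgraph) (A : {set K}) :
  #|A| <= 3 -> #|~: A| <= 3 ->
  ~~ has_copy (path_graph 4) (split_coloring A) Blue.
Proof.
move=> leA leAC; apply/existsP=> -[f /andP[/injectiveP f_inj /forallP fP]].
have same (x y : path_graph 4) : adj x y -> (f x \in A) = (f y \in A).
  move=> xy; have /forallP/(_ y)/implyP/(_ xy) := fP x.
  by move=> /(@colored_split _ _ Blue)/eqP.
(* Walking along the path from its first vertex never leaves the side of [A]. *)
have same0 (x : path_graph 4) : (f x \in A) = (f ord0 \in A).
  case: x => k; elim: k => [|k IHk] ltk; first by congr (f _ \in A); apply: val_inj.
  by rewrite -(IHk (ltnW ltk)); apply: same; rewrite /= /path_rel /= eqxx orbT.
have card_f : #|[set f x | x in [set: path_graph 4]]| = 4.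
  by rewrite card_imset // cardsT card_ord.
have [fA|fA] := boolP (f ord0 \in A).
  have /subset_leq_card : [set f x | x in [set: path_graph 4]] \subset A.
    by apply/subsetP=> _ /imsetP[x _ ->]; rewrite same0.
  by rewrite card_f leqNgt ltnS leA.
have /subset_leq_card : [set f x | x in [set: path_graph 4]] \subset ~: A.
  by apply/subsetP=> _ /imsetP[x _ ->]; rewrite inE same0.
by rewrite card_f leqNgt ltnS leAC.
Qed.

Lemma not_arrows_small (K : sgraph) :
  #|K| <= 6 -> ~~ arrows K butterfly (path_graph 4).
Proof.
move=> leK6; pose A := [set x in take 3 (enum K)].
have cardA : #|A| = minn 3 #|K|.
  rewrite cardsE (card_uniqP _) ?take_uniq ?enum_uniq // size_take_min.
  by rewrite -cardE.
apply/forallPn; exists (split_coloring A); rewrite negb_or.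
rewrite split_no_red_butterfly split_no_blue_path //; first by rewrite cardA geq_minl.
have := cardsC A; lia.
Qed.

(** * The values of the Ramsey number *)

Lemma multipartite_ramseyP j (G1 G2 : sgraph) m :
    arrows (complete_multipartite j m) G1 G2 ->
    (forall s, s < m -> ~~ arrows (complete_multipartite j s) G1 G2) ->
  multipartite_ramsey j G1 G2 = Some m.
Proof.
move=> arr_m min_m; rewrite /multipartite_ramsey.
case: boolp.pselect => [ex_s|[]]; last by exists m.
congr Some; case: ex_minnP => s arr_s /(_ m arr_m) le_sm.
apply/eqP; rewrite eqn_leq le_sm leqNgt.
by apply: contraL arr_s => /min_m.
Qed.

Theorem theorem3p4 (j : nat) (hj : 3 <= j) :
  multipartite_ramsey j butterfly (path_graph 4) =
    Some (if j == 3 then 3 else if j \in [:: 4; 5; 6] then 2 else 1).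
Proof.
have j_gt0 : 0 < j by apply: leq_trans hj.
apply: multipartite_ramseyP => [|s lts].
  have [->|j3] := eqVneq j 3.
    by apply: (refuted_arrows _ _ _ refuted_ramsey_clauses_3_3).
  have [_|j456] := ifPn.
    by apply: (refuted_arrows _ _ _ refuted_ramsey_clauses_4_2); lia.
  apply: (refuted_arrows _ _ _ refuted_ramsey_clauses_7_1) => //.
  by move: j456; rewrite !inE; lia.
(* Below the claimed value, [j * s] is at most 3 * 2 for [j = 3], at most 6 * 1 for [j] from 4 to 6,
   and 0 beyond. *)
apply: not_arrows_small; rewrite /= card_prod !card_ord.
by move: lts; rewrite !inE; case: eqP => [->|_]; [|case: ifPn]; nia.
Qed.
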